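(* Conditional bisimilarity and conditional environment congruence coincide: ${\simeq_C}={\simeq_E}$.
   Context: Composition of $f\colon A\to B$, $g\colon B\to C$ is written $f;g$. Fix a category $\mathbf C$ with distinguished object $0$ and a representative class $\kappa$ of commuting squares: for every commuting square $\alpha_1;\delta_1=\alpha_2;\delta_2$ there are $(\alpha_1,\alpha_2,\beta_1,\beta_2)\in\kappa$ (a commuting square) and $\gamma$ with $\delta_1=\beta_1;\gamma$, $\delta_2=\beta_2;\gamma$; $\kappa(\alpha_1,\alpha_2)$ is the set of $(\beta_1,\beta_2)$ with $(\alpha_1,\alpha_2,\beta_1,\beta_2)\in\kappa$. Conditions over $A$ are defined inductively as $(A,\mathcal Q,S)$, $\mathcal Q\in\{\forall,\exists\}$, $S$ a finite set of pairs $(h,\mathcal A')$ with $h\colon A\to A'$, $\mathcal A'$ a condition over $A'$. For $a\colon A\to B$: $a\models(A,\forall,S)$ iff for all $(h,\mathcal A')\in S$ and all $g$ with $a=h;g$, $g\models\mathcal A'$; $a\models(A,\exists,S)$ iff some $(h,\mathcal A')\in S$ and $g$ satisfy $a=h;g$, $g\models\mathcal A'$. $\mathcal A\models\mathcal B$: every arrow satisfying $\mathcal A$ satisfies $\mathcal B$. Boolean connectives have the standard semantics. Shift along $c\colon A\to B$: $(A,\mathcal Q,S)_{\downarrow c}=(B,\mathcal Q,\{(\beta,\mathcal A'_{\downarrow\alpha})\mid(h,\mathcal A')\in S,(\alpha,\beta)\in\kappa(h,c)\})$; it satisfies $c;d\models\mathcal A\iff d\models\mathcal A_{\downarrow c}$.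 A conditional reactive system is a set $\mathcal S$ of rules $(\ell,r,\mathcal R)$, $\ell,r\colon0\to I$, $\mathcal R$ a condition over $I$. Context step $a\xrightarrow[C]{f,\ \mathcal A}a'$ ($a\colon0\to J$, $f\colon J\to K$, $a'\colon0\to K$, $\mathcal A$ over $K$): there are a rule $(\ell,r,\mathcal R)\in\mathcal S$ and $c\colon I\to K$ with $a;f=\ell;c$, $a'=r;c$, $\mathcal A\models\mathcal R_{\downarrow c}$. Environment step $a\xrightarrow[E]{d}a'$ ($a,a'\colon0\to K$, $d\colon K\to J$): there are a rule $(\ell,r,\mathcal R)\in\mathcal S$ and $c$ with $a=\ell;c$, $a'=r;c$ and $c;d\models\mathcal R$. A conditional relation is a set of triples $(a,b,\mathcal C)$, $a,b\colon0\to J$, $\mathcal C$ a condition over $J$. $\mathcal D\models\bigvee_{i\in I}\mathcal E_i$ (possibly infinite $I$): every arrow satisfying $\mathcal D$ satisfies some $\mathcal E_i$. A conditional bisimulation is a conditional relation $R$ such that for each $(a,b,\mathcal C)\in R$ and each context step $a\xrightarrow[C]{f,\ \mathcal A}a'$ there are a (possibly infinite) index set $I$, context steps $b\xrightarrow[C]{f,\ \mathcal B_i}b'_i$ and conditions $\mathcal C'_i$ with $(a',b'_i,\mathcal C'_i)\in R$ and $\mathcal A\land\mathcal C_{\downarrow f}\models\bigvee_{i\in I}(\mathcal C'_i\land\mathcal B_i)$, and symmetrically for context steps of $b$; $\simeq_C$ is the set of triples contained in some conditional bisimulation. A conditional relation $R$ is a conditional congruence if it is reflexive ($(a,a,\mathcal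 C)\in R$ whenever $\mathcal C$ is a condition over the codomain of $a$), symmetric, transitive ($(a,b,\mathcal C),(b,c,\mathcal C)\in R$ implies $(a,c,\mathcal C)\in R$) and closed under contextualization ($(a,b,\mathcal C)\in R$ implies $(a;d,b;d,\mathcal C_{\downarrow d})\in R$). $R$ is a conditional environment bisimulation if whenever $(a,b,\mathcal C)\in R$ and $a\xrightarrow[E]{d}a'$ for some $d\models\mathcal C$, there are $b'$ with $b\xrightarrow[E]{d}b'$ and a condition $\mathcal C'$ with $d\models\mathcal C'$ and $(a',b',\mathcal C')\in R$; and symmetrically for environment steps of $b$. The conditional environment congruence $\simeq_E$ is the largest conditional environment bisimulation that is also a conditional congruence. *)

(* Defs.v *)
From Stdlib Require Import List.

Set Implicit Arguments.
Unset Strict Implicit.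
Unset Printing Implicit Defensive.

Record category := Category {
  ob :> Type;
  hom : ob -> ob -> Type;
  idn : forall A : ob, hom A A;
  comp : forall A B D : ob, hom A B -> hom B D -> hom A D;
  comp_idl : forall (A B : ob) (f : hom A B), comp (idn A) f = f;
  comp_idr : forall (A B : ob) (f : hom A B), comp f (idn B) = f;
  comp_assoc : forall (A B D E : ob) (f : hom A B) (g : hom B D) (h : hom D E),
    comp f (comp g h) = comp (comp f g) h
}.

Arguments hom {_} A B.
Arguments idn {_} A.
Arguments comp {_ A B D} f g.

(* Composition in diagrammatic order. *)
Notation "f ;; g" := (comp f g) (at level 40, left associativity).

(* A representative class of squares is given by its sets
   kappa(alpha1, alpha2) of pairs (beta1, beta2) completing the span
   (alpha1, alpha2).  These sets are finite, as is needed for the shift of a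
   condition to be a condition, so each of them is represented by a list whose
   order and repetitions are irrelevant. *)
Record repr_squares (C : category) := ReprSquares {
  kappa : forall A A1 A2 : C, hom A A1 -> hom A A2 ->
    list {D : C & (hom A1 D * hom A2 D)%type};
  kappa_commutes : forall (A A1 A2 D : C) (alpha1 : hom A A1) (alpha2 : hom A A2)
      (beta1 : hom A1 D) (beta2 : hom A2 D),
    In (existT _ D (beta1, beta2)) (kappa alpha1 alpha2) ->
    alpha1 ;; beta1 = alpha2 ;; beta2;
  kappa_representative : forall (A A1 A2 E : C)
      (alpha1 : hom A A1) (alpha2 : hom A A2)
      (delta1 : hom A1 E) (delta2 : hom A2 E),
    alpha1 ;; delta1 = alpha2 ;; delta2 ->
    exists (D : C) (beta1 : hom A1 D) (beta2 : hom A2 D) (gamma : hom D E),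
      In (existT _ D (beta1, beta2)) (kappa alpha1 alpha2) /\
      delta1 = beta1 ;; gamma /\ delta2 = beta2 ;; gamma
}.

Inductive quantifier := QForall | QExists.

(* The finite set of branches is represented by a list; its order and
   repetitions are irrelevant to satisfaction. *)
Inductive condition (C : category) (A : C) : Type :=
  Cond : quantifier -> list {A' : C & (hom A A' * condition A')%type} ->
         condition A.

(* The list is traversed by fold_right rather than quantified over with In to
   satisfy the guard checker; see sat_forall and sat_exists below. *)
Fixpoint sat (C : category) (A : C) (phi : condition A) (B : C) (a : hom A B)
    {struct phi} : Prop :=
  match phi with
  | Cond QForall s =>
      fold_right (fun p P =>
        match p with
        | existT _ A' (h, psi) => (forall g : hom A' B, a = h ;; g -> sat psi g)
        end /\ P) True s
  | Cond QExists s =>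
      fold_right (fun p P =>
        match p with
        | existT _ A' (h, psi) => (exists g : hom A' B, a = h ;; g /\ sat psi g)
        end \/ P) False s
  end.

Lemma sat_forall (C : category) (A B : C)
    (s : list {A' : C & (hom A A' * condition A')%type}) (a : hom A B) :
  sat (Cond QForall s) a <->
  forall (A' : C) (h : hom A A') (psi : condition A'),
    In (existT _ A' (h, psi)) s ->
    forall g : hom A' B, a = h ;; g -> sat psi g.
Proof.
simpl; induction s as [|[A1 [h1 psi1]] s IH]; simpl.
- split; [intros _ A' h psi [] | auto].
- rewrite IH; split.
  + intros [H1 H2] A' h psi [E | Hin]; [|exact (H2 _ _ _ Hin)].
    change (match existT _ A' (h, psi) with
            | existT _ A2 (h2, psi2) => forall g : hom A2 B, a = h2 ;; g -> sat psi2 g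
            end).
    rewrite <- E; exact H1.
  + intros H; split; [exact (H _ _ _ (or_introl eq_refl))|].
    intros A' h psi Hin; exact (H _ _ _ (or_intror Hin)).
Qed.

Lemma sat_exists (C : category) (A B : C)
    (s : list {A' : C & (hom A A' * condition A')%type}) (a : hom A B) :
  sat (Cond QExists s) a <->
  exists (A' : C) (h : hom A A') (psi : condition A'),
    In (existT _ A' (h, psi)) s /\
    exists g : hom A' B, a = h ;; g /\ sat psi g.
Proof.
simpl; induction s as [|[A1 [h1 psi1]] s IH]; simpl.
- split; [intros [] | intros (A' & h & psi & [] & _)].
- rewrite IH; split.
  + intros [H | (A' & h & psi & Hin & H)].
    * exists A1, h1, psi1; split; [left; reflexivity | exact H].
    * exists A', h, psi; split; [right; exact Hin | exact H].
  + intros (A' & h & psi & [E | Hin] & H).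
    * left.
      change (match existT (fun A' => (hom A A' * condition A')%type)
                      A1 (h1, psi1) with
              | existT _ A2 (h2, psi2) =>
                  exists g : hom A2 B, a = h2 ;; g /\ sat psi2 g
              end).
      rewrite E; exact H.
    * right; exists A', h, psi; split; assumption.
Qed.

Fixpoint shift (C : category) (K : repr_squares C) (A : C) (phi : condition A)
    (B : C) (c : hom A B) {struct phi} : condition B :=
  match phi with
  | Cond q s =>
      Cond q (flat_map (fun p =>
        match p with
        | existT _ A' (h, psi) =>
            map (fun k =>
              match k with
              | existT _ D (alpha, beta) => existT _ D (beta, shift K psi alpha)
              end) (kappa K h c)
        end) s)
  end.

(* A property of arrows out of A; the Boolean connectives, infinitary
   disjunction included, are interpreted on properties. *)
Definition arrow_pred (C : category) (A : C) : Type :=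
  forall B : C, hom A B -> Prop.

Definition sem (C : category) (A : C) (phi : condition A) : arrow_pred A :=
  fun B a => sat phi a.

Definition pred_and (C : category) (A : C) (P Q : arrow_pred A) : arrow_pred A :=
  fun B a => P B a /\ Q B a.

Definition pred_bigor (C : category) (A : C) (I : Type) (P : I -> arrow_pred A) :
    arrow_pred A :=
  fun B a => exists i : I, P i B a.

Definition entails (C : category) (A : C) (P Q : arrow_pred A) : Prop :=
  forall (B : C) (a : hom A B), P B a -> Q B a.

Record rule (C : category) (O : C) := Rule {
  interface : C;
  lhs : hom O interface;
  rhs : hom O interface;
  app_cond : condition interface
}.

Definition reactive_system (C : category) (O : C) : Type := rule O -> Prop.

Definition context_step (C : category) (K : repr_squares C) (O : C)
    (S : reactive_system O) (J L : C) (a : hom O J) (f : hom J L)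
    (phi : condition L) (a' : hom O L) : Prop :=
  exists (rho : rule O) (c : hom (interface rho) L),
    S rho /\ a ;; f = lhs rho ;; c /\ a' = rhs rho ;; c /\
    entails (sem phi) (sem (shift K (app_cond rho) c)).

Definition environment_step (C : category) (O : C) (S : reactive_system O)
    (L J : C) (a : hom O L) (d : hom L J) (a' : hom O L) : Prop :=
  exists (rho : rule O) (c : hom (interface rho) L),
    S rho /\ a = lhs rho ;; c /\ a' = rhs rho ;; c /\
    sat (app_cond rho) (c ;; d).

Definition cond_relation (C : category) (O : C) : Type :=
  forall J : C, hom O J -> hom O J -> condition J -> Prop.

Definition cond_bisimulation (C : category) (K : repr_squares C) (O : C)
    (S : reactive_system O) (R : cond_relation O) : Prop :=
  forall (J : C) (a b : hom O J) (phi : condition J), R J a b phi ->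
    (forall (L : C) (f : hom J L) (chi : condition L) (a' : hom O L),
       context_step K S a f chi a' ->
       exists (I : Type) (chi' : I -> condition L) (b' : I -> hom O L)
              (phi' : I -> condition L),
         (forall i, context_step K S b f (chi' i) (b' i)) /\
         (forall i, R L a' (b' i) (phi' i)) /\
         entails (pred_and (sem chi) (sem (shift K phi f)))
                 (pred_bigor (fun i => pred_and (sem (phi' i)) (sem (chi' i))))) /\
    (forall (L : C) (f : hom J L) (chi : condition L) (b' : hom O L),
       context_step K S b f chi b' ->
       exists (I : Type) (chi' : I -> condition L) (a' : I -> hom O L)
              (phi' : I -> condition L),
         (forall i, context_step K S a f (chi' i) (a' i)) /\
         (forall i, R L (a' i) b' (phi' i)) /\
         entails (pred_and (sem chi) (sem (shift K phi f)))
                 (pred_bigor (fun i => pred_and (sem (phi' i)) (sem (chi' i))))).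

Definition cond_bisimilar (C : category) (K : repr_squares C) (O : C)
    (S : reactive_system O) : cond_relation O :=
  fun J a b phi => exists R : cond_relation O,
    cond_bisimulation K S R /\ R J a b phi.

Record cond_congruence (C : category) (K : repr_squares C) (O : C)
    (R : cond_relation O) : Prop := CondCongruence {
  cc_refl : forall (J : C) (a : hom O J) (phi : condition J), R J a a phi;
  cc_sym : forall (J : C) (a b : hom O J) (phi : condition J),
    R J a b phi -> R J b a phi;
  cc_trans : forall (J : C) (a b c : hom O J) (phi : condition J),
    R J a b phi -> R J b c phi -> R J a c phi;
  cc_context : forall (J L : C) (a b : hom O J) (phi : condition J) (d : hom J L),
    R J a b phi -> R L (a ;; d) (b ;; d) (shift K phi d)
}.

Definition cond_env_bisimulation (C : category) (O : C) (S : reactive_system O)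
    (R : cond_relation O) : Prop :=
  forall (L : C) (a b : hom O L) (phi : condition L), R L a b phi ->
    (forall (J : C) (d : hom L J) (a' : hom O L),
       sat phi d -> environment_step S a d a' ->
       exists (b' : hom O L) (phi' : condition L),
         environment_step S b d b' /\ sat phi' d /\ R L a' b' phi') /\
    (forall (J : C) (d : hom L J) (b' : hom O L),
       sat phi d -> environment_step S b d b' ->
       exists (a' : hom O L) (phi' : condition L),
         environment_step S a d a' /\ sat phi' d /\ R L a' b' phi').

Definition is_largest (C : category) (O : C) (P : cond_relation O -> Prop)
    (E : cond_relation O) : Prop :=
  P E /\
  forall R : cond_relation O, P R ->
    forall (J : C) (a b : hom O J) (phi : condition J),
      R J a b phi -> E J a b phi.

Definition env_bisim_congruence (C : category) (K : repr_squares C) (O : C)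
    (S : reactive_system O) (R : cond_relation O) : Prop :=
  cond_env_bisimulation S R /\ cond_congruence K R.

(* The union of all conditional environment bisimulations that are conditional
   congruences.  Such relations are not closed under union in any obvious way,
   so that this union is itself one of them has to be proved. *)
Definition cond_env_congruence (C : category) (K : repr_squares C) (O : C)
    (S : reactive_system O) : cond_relation O :=
  fun J a b phi => exists R : cond_relation O,
    env_bisim_congruence K S R /\ R J a b phi.

(* Main.v *)
From Stdlib Require Import List.
Require Import Defs.

Set Implicit Arguments.
Unset Strict Implicit.
Unset Printing Implicit Defensive.

(** An environment step of [a ;; f] under [d] is the same thing as a context
    step of [a] along [f] whose condition is satisfied by [d].  Reading the
    infinite disjunction pointwise, a conditional bisimulation is therefore a
    relation in which, for all [f] and [d] such that [f ;; d] satisfies the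
    condition of a triple [(a, b)], the environment steps of [a ;; f] and
    [b ;; f] under [d] answer each other.  Taking [f] to be an identity gives
    an environment bisimulation; conversely, closure under contextualization
    supplies the quantification over [f].  In this form the congruence
    properties of conditional bisimilarity are coinductive arguments. *)

(** * Semantics of conditions: induction, shifting, truth and conjunction *)

Section Conditions.

Variable C : category.

(** Conditions are nested inside lists of branches; an inner induction on the list supplies one
    hypothesis per branch. *)
Lemma condition_nested_ind (P : forall A : C, condition A -> Prop) :
  (forall (A : C) (q : quantifier) (s : list {A' : C & (hom A A' * condition A')%type}),
     (forall p, In p s -> P (projT1 p) (snd (projT2 p))) -> P A (Cond q s)) ->
  forall (A : C) (phi : condition A), P A phi.
Proof.
intros H; fix IH 2; intros A [q s]; apply H; clear H q.
induction s as [|[A' [h psi]] s IHs]; intros p Hp;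
  [destruct Hp | destruct Hp as [Hp | Hp]].
- rewrite <- Hp; exact (IH A' psi).
- exact (IHs p Hp).
Qed.

(* Quantifying over whole branches, as opposed to [sat_forall] and
   [sat_exists], avoids inverting equalities between dependent pairs. *)
Lemma sat_forall_branch (A B : C)
    (s : list {A' : C & (hom A A' * condition A')%type}) (a : hom A B) :
  sat (Cond QForall s) a <->
  forall p, In p s -> forall g : hom (projT1 p) B,
    a = fst (projT2 p) ;; g -> sat (snd (projT2 p)) g.
Proof.
rewrite sat_forall; split.
- intros H [A' [h psi]] Hp g; exact (H A' h psi Hp g).
- intros H A' h psi Hp g; exact (H _ Hp g).
Qed.

Lemma sat_exists_branch (A B : C)
    (s : list {A' : C & (hom A A' * condition A')%type}) (a : hom A B) :
  sat (Cond QExists s) a <->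
  exists p, In p s /\ exists g : hom (projT1 p) B,
    a = fst (projT2 p) ;; g /\ sat (snd (projT2 p)) g.
Proof.
rewrite sat_exists; split.
- intros (A' & h & psi & Hp & H); exists (existT _ A' (h, psi)); split; assumption.
- intros ([A' [h psi]] & Hp & H); exists A', h, psi; split; assumption.
Qed.

(** A factorization [c ;; d = h ;; g] is a commuting square, so it passes through a square of
    [kappa h c]; conversely, a factorization of [d] through a branch of the shift gives one of
    [c ;; d] since these squares commute. Each quantifier needs both facts, in opposite
    directions. *)
Lemma sat_shift (K : repr_squares C) (A : C) (phi : condition A) (B D : C)
    (c : hom A B) (d : hom B D) :
  sat (shift K phi c) d <-> sat phi (c ;; d).
Proof.
revert A phi B D c d.
refine (condition_nested_ind _).
intros A [|] s IH B D c d; simpl shift.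
- rewrite !sat_forall_branch; split.
  + intros H [A' [h psi]] Hp g E; simpl in *.
    destruct (kappa_representative K (eq_sym E))
      as (X & alpha & beta & gamma & Hk & -> & ->).
    apply (IH _ Hp).
    apply (H (existT _ X (beta, shift K psi alpha))); [|reflexivity].
    apply in_flat_map; exists (existT _ A' (h, psi)); split; [exact Hp|].
    apply in_map_iff; exists (existT _ X (alpha, beta)); split;
      [reflexivity | exact Hk].
  + intros H p Hp.
    apply in_flat_map in Hp as ([A' [h psi]] & Hs & Hp).
    apply in_map_iff in Hp as ([X [alpha beta]] & <- & Hk); simpl.
    intros g ->; apply (IH _ Hs); simpl.
    apply (H _ Hs); simpl.
    rewrite !comp_assoc, (kappa_commutes Hk); reflexivity.
- rewrite !sat_exists_branch; split.
  + intros (p & Hp & H).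
    apply in_flat_map in Hp as ([A' [h psi]] & Hs & Hp).
    apply in_map_iff in Hp as ([X [alpha beta]] & <- & Hk); simpl in *.
    destruct H as (g & -> & Hg).
    exists (existT _ A' (h, psi)); split; [exact Hs|].
    exists (alpha ;; g); simpl; split.
    * rewrite !comp_assoc, (kappa_commutes Hk); reflexivity.
    * apply (IH _ Hs); exact Hg.
  + intros ([A' [h psi]] & Hp & g & E & Hg); simpl in *.
    destruct (kappa_representative K (eq_sym E))
      as (X & alpha & beta & gamma & Hk & -> & ->).
    exists (existT _ X (beta, shift K psi alpha)); split.
    * apply in_flat_map; exists (existT _ A' (h, psi)); split; [exact Hp|].
      apply in_map_iff; exists (existT _ X (alpha, beta)); split;
        [reflexivity | exact Hk].
    * exists gamma; split; [reflexivity|].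
      apply (IH _ Hp); exact Hg.
Qed.

Definition cond_true (A : C) : condition A := Cond QForall nil.

Lemma sat_cond_true (A B : C) (a : hom A B) : sat (cond_true A) a.
Proof. exact I. Qed.

(** Branching along identities leaves the arrow itself as the only factor, so both conditions are
    tested on it. *)
Definition cond_and (A : C) (phi psi : condition A) : condition A :=
  Cond QForall (existT _ A (idn A, phi) :: existT _ A (idn A, psi) :: nil).

Lemma sat_cond_and (A B : C) (phi psi : condition A) (a : hom A B) :
  sat (cond_and phi psi) a <-> sat phi a /\ sat psi a.
Proof.
simpl; split.
- intros (H1 & H2 & _); split; [apply H1 | apply H2]; rewrite comp_idl; reflexivity.
- intros (H1 & H2); repeat split; intros g; rewrite comp_idl; intros <-; assumption.
Qed.

End Conditions.

Section Bisimilarity.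

Variables (C : category) (K : repr_squares C) (O : C) (S : reactive_system O).

Lemma environment_step_context (J L M : C) (a : hom O J) (f : hom J L)
    (d : hom L M) (a' : hom O L) :
  environment_step S (a ;; f) d a' <->
  exists chi, context_step K S a f chi a' /\ sat chi d.
Proof.
split.
- intros (rho & c & HS & Ha & Ha' & Hd).
  (* This is the weakest condition that can label a context step using [rho] and [c]. *)
  exists (shift K (app_cond rho) c); split.
  + exists rho, c; repeat split; try assumption.
    intros B e He; exact He.
  + apply sat_shift; exact Hd.
- intros (chi & (rho & c & HS & Ha & Ha' & Hchi) & Hd).
  exists rho, c; repeat split; try assumption.
  apply (sat_shift K); exact (Hchi _ _ Hd).
Qed.

(** Pointwise reading of the infinite disjunction. [Q] is arbitrary so that the lemma serves a
    relation and its converse, hence both clauses of a bisimulation. *)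
Lemma context_answer_iff (J L : C) (a b : hom O J) (phi : condition J)
    (f : hom J L) (Q : hom O L -> hom O L -> condition L -> Prop) :
  (forall (chi : condition L) (a' : hom O L), context_step K S a f chi a' ->
     exists (I : Type) (chi' : I -> condition L) (b' : I -> hom O L)
            (phi' : I -> condition L),
       (forall i, context_step K S b f (chi' i) (b' i)) /\
       (forall i, Q a' (b' i) (phi' i)) /\
       entails (pred_and (sem chi) (sem (shift K phi f)))
               (pred_bigor (fun i => pred_and (sem (phi' i)) (sem (chi' i))))) <->
  (forall (M : C) (d : hom L M) (a' : hom O L),
     sat phi (f ;; d) -> environment_step S (a ;; f) d a' ->
     exists (b' : hom O L) (phi' : condition L),
       environment_step S (b ;; f) d b' /\ sat phi' d /\ Q a' b' phi').
Proof.
split.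
- intros H M d a' Hphi Ha.
  apply environment_step_context in Ha as (chi & Ha & Hchi).
  destruct (H chi a' Ha) as (I & chi' & b' & phi' & Hb & HQ & Hent).
  destruct (Hent M d) as (i & Hphi' & Hchi').
  { split; [exact Hchi | apply sat_shift; exact Hphi]. }
  exists (b' i), (phi' i); repeat split; [|exact Hphi' | apply HQ].
  apply environment_step_context; exists (chi' i); split; [apply Hb | exact Hchi'].
- intros H chi a' Ha.
  (* Indexing by all admissible answers makes choice unnecessary. *)
  exists {x : condition L * hom O L * condition L |
           context_step K S b f (fst (fst x)) (snd (fst x)) /\
           Q a' (snd (fst x)) (snd x)},
    (fun i => fst (fst (proj1_sig i))), (fun i => snd (fst (proj1_sig i))),
    (fun i => snd (proj1_sig i)).
  repeat split; [intros i; apply (proj2_sig i) .. |].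
  intros M d [Hchi Hphi].
  destruct (H M d a') as (b' & phi' & Hb & Hphi' & HQ).
  { apply (sat_shift K); exact Hphi. }
  { apply environment_step_context; exists chi; split; assumption. }
  apply environment_step_context in Hb as (chi' & Hb & Hchi').
  exists (exist _ (chi', b', phi') (conj Hb HQ)); split; assumption.
Qed.

(** * Progress between relations, and coinduction for conditional bisimilarity *)

Definition flip_relation (R : cond_relation O) : cond_relation O :=
  fun J a b phi => R J b a phi.

(** One clause of the pointwise form of conditional bisimulation; answers may land in a different
    relation [T], as coinduction requires. *)
Definition progresses (R T : cond_relation O) : Prop :=
  forall (J : C) (a b : hom O J) (phi : condition J), R J a b phi ->
  forall (L M : C) (f : hom J L) (d : hom L M) (a' : hom O L),
    sat phi (f ;; d) -> environment_step S (a ;; f) d a' ->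
    exists (b' : hom O L) (phi' : condition L),
      environment_step S (b ;; f) d b' /\ sat phi' d /\ T L a' b' phi'.

Lemma cond_bisimulation_progresses (R : cond_relation O) :
  cond_bisimulation K S R <->
  progresses R R /\ progresses (flip_relation R) (flip_relation R).
Proof.
split.
- intros H; split; intros J a b phi HR L M f.
  + exact (proj1 (context_answer_iff a b phi f (R L))
             (proj1 (H J a b phi HR) L f) M).
  + exact (proj1 (context_answer_iff a b phi f (@flip_relation R L))
             (proj2 (H J b a phi HR) L f) M).
- intros [H1 H2] J a b phi HR; split; intros L f.
  + exact (proj2 (context_answer_iff a b phi f (R L))
             (fun M => H1 J a b phi HR L M f)).
  + exact (proj2 (context_answer_iff b a phi f (@flip_relation R L))
             (fun M => H2 J b a phi HR L M f)).
Qed.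

Lemma progresses_weaken (R T T' : cond_relation O) :
  (forall J a b phi, T J a b phi -> T' J a b phi) ->
  progresses R T -> progresses R T'.
Proof.
intros HT H J a b phi HR L M f d a' Hphi Ha.
destruct (H J a b phi HR L M f d a' Hphi Ha) as (b' & phi' & Hb & Hphi' & HT').
exists b', phi'; auto.
Qed.

Notation bisimilar := (cond_bisimilar K S).

Lemma cond_bisimilar_sym (J : C) (a b : hom O J) (phi : condition J) :
  bisimilar a b phi -> bisimilar b a phi.
Proof.
intros (R & HR & Hab); exists (flip_relation R); split; [|exact Hab].
apply cond_bisimulation_progresses in HR as [H1 H2].
apply cond_bisimulation_progresses; split; [exact H2 | exact H1].
Qed.

Lemma cond_bisimilar_progresses : progresses bisimilar bisimilar.
Proof.
intros J a b phi (R & HR & Hab).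
destruct (proj1 (cond_bisimulation_progresses R) HR) as [H _].
refine (progresses_weaken _ H Hab).
intros J' x y psi Hxy; exists R; split; assumption.
Qed.

(** The union of [R] with bisimilarity is itself a conditional bisimulation; symmetry reduces its
    two clauses to one. *)
Lemma cond_bisimilar_coind (R : cond_relation O) :
  (forall J a b phi, R J a b phi -> R J b a phi) ->
  progresses R (fun J a b phi => R J a b phi \/ bisimilar a b phi) ->
  forall J a b phi, R J a b phi -> bisimilar a b phi.
Proof.
intros Rsym HR J a b phi Hab.
set (T := fun J (a b : hom O J) phi => R J a b phi \/ bisimilar a b phi).
assert (HT : progresses T T).
{ intros J' x y psi [H | H].
  - exact (HR _ _ _ _ H).
  - refine (progresses_weaken _ cond_bisimilar_progresses H).
    intros; right; assumption. }
assert (Tsym : forall J a b phi, T J a b phi -> T J b a phi).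
{ intros J' x y psi [H | H];
    [left; apply Rsym | right; apply cond_bisimilar_sym]; exact H. }
exists T; split; [|left; exact Hab].
apply cond_bisimulation_progresses; split; [exact HT|].
intros J' x y psi H.
exact (progresses_weaken (T' := flip_relation T) (fun J x y psi => Tsym J x y psi)
         HT (Tsym _ _ _ _ H)).
Qed.

(** * Congruence properties of conditional bisimilarity *)

Lemma cond_bisimilar_refl (J : C) (a : hom O J) (phi : condition J) :
  bisimilar a a phi.
Proof.
apply (@cond_bisimilar_coind (fun J a b _ => a = b)); [auto| |reflexivity].
intros J' x y psi <- L M f d x' _ Hx.
(* The candidate relation admits every condition, so one satisfied by every [d] can be chosen. *)
exists x', (cond_true L); auto using sat_cond_true.
Qed.

Lemma cond_bisimilar_trans (J : C) (a b c : hom O J) (phi : condition J) :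
  bisimilar a b phi -> bisimilar b c phi -> bisimilar a c phi.
Proof.
intros Hab Hbc.
(* The two answers come with different conditions, so the candidate relation
   admits any condition stronger than both. *)
apply (@cond_bisimilar_coind (fun J a c phi => exists b phi1 phi2,
         bisimilar a b phi1 /\ bisimilar b c phi2 /\
         forall M (d : hom J M), sat phi d -> sat phi1 d /\ sat phi2 d)).
- intros J' x z psi (y & psi1 & psi2 & Hxy & Hyz & Hpsi).
  exists y, psi2, psi1; repeat split; try (apply cond_bisimilar_sym; assumption);
    apply Hpsi; assumption.
- intros J' x z psi (y & psi1 & psi2 & Hxy & Hyz & Hpsi) L M f d x' Hd Hx.
  apply Hpsi in Hd as [Hd1 Hd2].
  destruct (cond_bisimilar_progresses Hxy Hd1 Hx) as (y' & chi1 & Hy & Hchi1 & Hxy').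
  destruct (cond_bisimilar_progresses Hyz Hd2 Hy) as (z' & chi2 & Hz & Hchi2 & Hyz').
  exists z', (cond_and chi1 chi2); split; [exact Hz | split].
  + apply sat_cond_and; split; assumption.
  + left; exists y', chi1, chi2; split; [exact Hxy' | split; [exact Hyz'|]].
    intros N e; apply sat_cond_and.
- exists b, phi, phi; auto.
Qed.

(** A context [g] of [u ;; e] is the context [e ;; g] of [u], over which progress already
    quantifies; the answers land in bisimilarity itself. *)
Lemma cond_bisimilar_context (J L : C) (a b : hom O J) (phi : condition J)
    (d : hom J L) :
  bisimilar a b phi -> bisimilar (a ;; d) (b ;; d) (shift K phi d).
Proof.
intros Hab.
apply (@cond_bisimilar_coind (fun L x y psi =>
         exists J (a b : hom O J) phi (d : hom J L), bisimilar a b phi /\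
           x = a ;; d /\ y = b ;; d /\ psi = shift K phi d)).
- intros L' x y psi (J' & u & v & chi & e & Huv & -> & -> & ->).
  exists J', v, u, chi, e; auto using cond_bisimilar_sym.
- intros L' x y psi (J' & u & v & chi & e & Huv & -> & -> & ->) N M f g x' Hg Hx.
  apply sat_shift in Hg.
  rewrite <- comp_assoc in Hx; rewrite comp_assoc in Hg.
  destruct (cond_bisimilar_progresses Huv Hg Hx) as (y' & chi' & Hy & Hchi' & Hxy).
  exists y', chi'; rewrite <- comp_assoc; auto.
- exists J, a, b, phi, d; auto.
Qed.

(** * Comparison with the conditional environment congruence *)

Lemma progresses_environment (R T : cond_relation O) (L M : C) (a b : hom O L)
    (phi : condition L) (d : hom L M) (a' : hom O L) :
  progresses R T -> R L a b phi -> sat phi d -> environment_step S a d a' ->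
  exists (b' : hom O L) (phi' : condition L),
    environment_step S b d b' /\ sat phi' d /\ T L a' b' phi'.
Proof.
intros H HR Hphi Ha.
rewrite <- (comp_idl d) in Hphi; rewrite <- (comp_idr a) in Ha.
rewrite <- (comp_idr b).
exact (H _ _ _ _ HR _ _ _ _ _ Hphi Ha).
Qed.

Lemma cond_bisimilar_env_bisim_congruence : env_bisim_congruence K S bisimilar.
Proof.
split.
- intros L a b phi Hab; split; intros J d.
  + intros a'; exact (progresses_environment cond_bisimilar_progresses Hab).
  + intros b' Hd Hb.
    destruct (progresses_environment cond_bisimilar_progresses
                (cond_bisimilar_sym Hab) Hd Hb) as (a' & phi' & Ha & Hphi' & H).
    exists a', phi'; auto using cond_bisimilar_sym.
- split.
  + exact cond_bisimilar_refl.
  + exact cond_bisimilar_sym.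
  + exact cond_bisimilar_trans.
  + exact cond_bisimilar_context.
Qed.

Lemma env_bisim_congruence_bisimulation (R : cond_relation O) :
  env_bisim_congruence K S R -> cond_bisimulation K S R.
Proof.
intros [Hbis Hcong].
apply cond_bisimulation_progresses; split;
  intros J a b phi HR L M f d a' Hphi; apply (sat_shift K) in Hphi;
  pose proof (cc_context Hcong f HR) as HRf.
- exact (proj1 (Hbis _ _ _ _ HRf) _ _ _ Hphi).
- exact (proj2 (Hbis _ _ _ _ HRf) _ _ _ Hphi).
Qed.

Lemma cond_bisimilar_iff_env_congruence (J : C) (a b : hom O J) (phi : condition J) :
  bisimilar a b phi <-> cond_env_congruence K S a b phi.
Proof.
split.
- intros H; exists bisimilar; split;
    [exact cond_bisimilar_env_bisim_congruence | exact H].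
- intros (R & HR & H); exists R; split;
    [exact (env_bisim_congruence_bisimulation HR) | exact H].
Qed.

(** The bisimulation clauses pass to the union directly; the congruence properties are transported
    from conditional bisimilarity, since two triples to be composed may come from different
    relations. *)
Lemma cond_env_congruence_env_bisim_congruence :
  env_bisim_congruence K S (cond_env_congruence K S).
Proof.
split.
- intros L a b phi (R & HR & Hab).
  destruct (proj1 HR L a b phi Hab) as [H1 H2]; split; intros J d x' Hd Hx.
  + destruct (H1 J d x' Hd Hx) as (y' & phi' & Hy & Hphi' & Hxy).
    exists y', phi'; repeat split; try assumption; exists R; split; assumption.
  + destruct (H2 J d x' Hd Hx) as (y' & phi' & Hy & Hphi' & Hxy).
    exists y', phi'; repeat split; try assumption; exists R; split; assumption.
- split; intros; rewrite <- cond_bisimilar_iff_env_congruence in *.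
  + apply cond_bisimilar_refl.
  + apply cond_bisimilar_sym; assumption.
  + eapply cond_bisimilar_trans; eassumption.
  + apply cond_bisimilar_context; assumption.
Qed.

End Bisimilarity.

Theorem theorem6p4 (C : category) (K : repr_squares C) (O : C)
    (S : reactive_system O) :
  is_largest (env_bisim_congruence K S) (cond_env_congruence K S) /\
  forall (J : C) (a b : hom O J) (phi : condition J),
    cond_bisimilar K S a b phi <-> cond_env_congruence K S a b phi.
Proof.
split; [split|].
- apply cond_env_congruence_env_bisim_congruence.
- intros R HR J a b phi H; exists R; split; assumption.
- apply cond_bisimilar_iff_env_congruence.
Qed.
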